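(* Let $X$ and $Y$ be nonempty sets, let $0$ and $1$ be two fixed elements of $X$, and let $\Pi\colon D\to Y$ be a pivotal function, where $D\subseteq X\times Y^2$. A nonempty subclass $C$ of $\Gamma_{\Pi}$ is UM-characterized if and only if it is pivotally characterized. Moreover, if any of these conditions holds, then $C=\Gamma_{\Pi_C}$.
   Context: Throughout, arities satisfy $n\geqslant 1$, $[n]=\{1,\ldots,n\}$, and $U=\bigcup_{n\geqslant 1}Y^{X^n}$ is the set of all functions $X^n\to Y$ of all arities $n\geqslant1$. For $\mathbf{x}\in X^n$, $k\in[n]$ and $a\in X$, $\mathbf{x}_k^a$ is the $n$-tuple whose $i$-th coordinate is $a$ if $i=k$ and $x_i$ otherwise. Pivotal decomposition. A pivotal function is a function $\Pi\colon D\to Y$ with $D\subseteq X\times Y^2$. For $f\colon X^n\to Y$ let $R_f=\{(f(\mathbf{x}_k^1),f(\mathbf{x}_k^0)):\mathbf{x}\in X^n,~k\in[n]\}$. The function $f$ is $\Pi$-decomposable if $D\supseteq X\times R_f$ and $f(\mathbf{x})=\Pi(x_k,f(\mathbf{x}_k^1),f(\mathbf{x}_k^0))$ for all $\mathbf{x}\in X^n$ and $k\in[n]$. Unary sections and essential arguments. For $\mathbf{a}\in X^n$ and $k\in[n]$, the unary section $f_k^{\mathbf{a}}\colon X\to Y$ is $f_k^{\mathbf{a}}(x)=f(\mathbf{a}_k^x)$. The $k$-th argument of $f$ is inessential if $f_k^{\mathbf{a}}$ is constant for every $\mathbf{a}\in X^n$, and essential otherwise. A unary section $f_k^{\mathbf{a}}$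 is called an essential unary section of $f$ if the $k$-th argument of $f$ is essential (the section itself may be constant). Equivalence. For $f\colon X^n\to Y$ and $\sigma\colon[n]\to[m]$, let $f_\sigma\colon X^m\to Y$ be $f_\sigma(\mathbf{a})=f(a_{\sigma(1)},\ldots,a_{\sigma(n)})$. For $f\colon X^n\to Y$ and $g\colon X^m\to Y$, write $f\equiv g$ ($f$ and $g$ are equivalent) if there exist maps $\sigma\colon[m]\to[n]$ and $\mu\colon[n]\to[m]$ such that $f=g_\sigma$ and $g=f_\mu$. Classes. $\Gamma_\Pi$ is the subclass of $U$ of functions that are equivalent to a $\Pi$-decomposable function having no essential argument or no inessential argument. A class $C\subseteq U$ is pivotally characterized if $C=\Gamma_{\Pi'}$ for some pivotal function $\Pi'$. A class $C\subseteq U$ is UM-characterized (characterized by its unary members) if (i) a nonconstant function $f$ is in $C$ if and only if all its essential unary sections are in $C$, and (ii) if $f$ is a constant function in $C$ and $g\equiv f$, then $g\in C$. For $C\subseteq\Gamma_\Pi$, let $R_C=\{(f(1),f(0)): f\in C \text{ unary}\}$, and let $\Pi_C$ be the restriction of $\Pi$ to $X\times R_C$. *)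

(* Defs.v *)
From mathcomp Require Import all_boot.
From mathcomp Require Import boolp classical_sets functions.

Set Implicit Arguments.
Unset Strict Implicit.
Unset Printing Implicit Defensive.

Local Open Scope classical_set_scope.

(* The set U of all functions X^n -> Y with n >= 1; the arity of [Fct n f] is
   n.+1, and its arguments are indexed by 0, ..., n. *)
Record fct (X Y : Type) : Type :=
  Fct { pred_arity : nat; fct_val :> (X ^ pred_arity.+1)%type -> Y }.

Arguments fct_val {X Y} f _ : rename.

Notation arity f := (pred_arity f).+1.

Section Functions.
Context {X Y : Type}.
Implicit Types (f g : fct X Y) (C : set (fct X Y)).

Definition subst_at n (x : (X ^ n)%type) (k : 'I_n) (a : X) : (X ^ n)%type :=
  [ffun i => if i == k then a else x i].

Definition is_constant (T : Type) (h : T -> Y) : Prop :=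
  exists c : Y, forall t, h t = c.

Definition unary_section f (a : (X ^ arity f)%type) (k : 'I_(arity f)) : X -> Y :=
  fun x => f (subst_at a k x).
Arguments unary_section : clear implicits.

Definition inessential f (k : 'I_(arity f)) : Prop :=
  forall a : (X ^ arity f)%type, is_constant (unary_section f a k).
Arguments inessential : clear implicits.

Definition essential f (k : 'I_(arity f)) : Prop := ~ inessential f k.
Arguments essential : clear implicits.

(* Unary functions are handled as maps X -> Y, identifying X^1 with X. *)
Definition unary (u : X -> Y) : fct X Y :=
  @Fct X Y 0 (fun x => u (x ord0)).

Definition relabel n m (sigma : 'I_n -> 'I_m) (f : (X ^ n)%type -> Y) :
    (X ^ m)%type -> Y :=
  fun a => f [ffun i => a (sigma i)].

Definition equivalent f g : Prop :=
  exists (sigma : 'I_(arity g) -> 'I_(arity f))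
         (mu : 'I_(arity f) -> 'I_(arity g)),
    fct_val f = relabel sigma g /\ fct_val g = relabel mu f.

Definition UM_characterized C : Prop :=
  (forall f, ~ is_constant f ->
     (C f <-> forall (k : 'I_(arity f)) (a : (X ^ arity f)%type),
                essential f k -> C (unary (unary_section f a k))))
  /\ (forall f g, is_constant f -> C f -> equivalent g f -> C g).

End Functions.

Arguments unary_section {X Y} f a k _.
Arguments inessential {X Y} f k.
Arguments essential {X Y} f k.

(* A pivotal function is a map [Pi : D -> Y] on the subtype associated with a
   set [D] of triples, written (x, (y1, y0)). *)
Section Pivotal.
Context {X Y : Type} (zero one : X).
Implicit Types (f g : fct X Y) (C : set (fct X Y)) (D : set (X * (Y * Y))).

Definition pivot_pairs f : set (Y * Y) :=
  [set p | exists (x : (X ^ arity f)%type) (k : 'I_(arity f)),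
     p = (f (subst_at x k one), f (subst_at x k zero))].

(* By the first clause the point [p] of the second one always exists, and it is
   unique since membership in [D] is proof-irrelevant. *)
Definition decomposable D (Pi : D -> Y) f : Prop :=
  [set: X] `*` pivot_pairs f `<=` D /\
  forall (x : (X ^ arity f)%type) (k : 'I_(arity f)) (p : D),
    val p = (x k, (f (subst_at x k one), f (subst_at x k zero))) ->
    f x = Pi p.

Definition Gamma D (Pi : D -> Y) : set (fct X Y) :=
  [set f | exists g, [/\ equivalent f g, decomposable Pi g &
     (forall k : 'I_(arity g), ~ essential g k) \/
     (forall k : 'I_(arity g), ~ inessential g k)]].

Definition pivotally_characterized C : Prop :=
  exists (D : set (X * (Y * Y))) (Pi : D -> Y), C = Gamma Pi.

Definition class_pairs C : set (Y * Y) :=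
  [set p | exists u : X -> Y, C (unary u) /\ p = (u one, u zero)].

(* Pi_C. When C is included in Gamma Pi, the unary members of C are
   Pi-decomposable, so that X * R_C is included in D and is the domain of the
   restriction. *)
Definition pivotal_restrict D (Pi : D -> Y) C :
    D `&` ([set: X] `*` class_pairs C) -> Y :=
  fun p => Pi (subfun (@subIsetl _ D ([set: X] `*` class_pairs C)) p).

End Pivotal.

Arguments pivotal_restrict {X Y} zero one {D} Pi C _.

(* Main.v *)
Require Import Defs.
From mathcomp Require Import all_boot.
From mathcomp Require Import boolp classical_sets functions.

(** Everything is decided on unary functions. Deleting inessential arguments
    shows that a nonconstant function f is equivalent to some g all of whose
    arguments are essential ([nonconstant_reduction]), and passing from f to
    such a g only drops inessential arguments and renames the others, so the
    essential unary sections of f are exactly the unary sections of g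
    ([essential_section_reduced], [reduced_section_essential]). Since the
    decomposition of g along its k-th argument only involves the values of one
    unary section, g is decomposable if and only if all its unary sections are
    ([decomposable_sections]). Hence a nonconstant f is in Gamma Pi if and
    only if its essential unary sections are Pi-decomposable
    ([Gamma_nonconstant]), and a unary function is in Gamma Pi if and only if
    it is itself Pi-decomposable ([Gamma_unary]): every class Gamma Pi is UM-characterized.

    For the rest, two UM-characterized classes with the same unary members are
    equal ([UM_characterized_eq]). If C is UM-characterized, this applies to C
    and to Gamma Pi_C: a unary member of C is Pi-decomposable with its pair of
    values at 1 and 0 in R_C; and if a unary u is Pi_C-decomposable, some
    member v of C agrees with u at 1 and 0, so that u = v because both are
    computed by Pi from these two values. *)

Set Implicit Arguments.
Unset Strict Implicit.
Unset Printing Implicit Defensive.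

Local Open Scope classical_set_scope.

(** * Equivalence and unary sections *)

Section Equivalence.
Context {X Y : Type}.
Implicit Types (f g h : fct X Y).

Lemma equivalent_refl f : equivalent f f.
Proof.
by exists id, id; split; apply/funext => x; rewrite /relabel; congr (fct_val f _);
  apply/ffunP => i; rewrite ffunE.
Qed.

Lemma equivalent_sym f g : equivalent f g -> equivalent g f.
Proof. by move=> [s [m [fE gE]]]; exists m, s. Qed.

Lemma relabel_comp n m l (s : 'I_n -> 'I_m) (t : 'I_m -> 'I_l)
    (h : (X ^ n)%type -> Y) :
  relabel t (relabel s h) = relabel (t \o s) h.
Proof.
by apply/funext => x; rewrite /relabel; congr h; apply/ffunP => i; rewrite !ffunE.
Qed.

Lemma equivalent_trans f g h :
  equivalent f g -> equivalent g h -> equivalent f h.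
Proof.
move=> [s1 [m1 [fE gE]]] [s2 [m2 [gE' hE]]].
exists (s1 \o s2), (m2 \o m1); split.
- by rewrite -relabel_comp -gE'.
- by rewrite -relabel_comp -gE.
Qed.

Lemma equivalent_constant f g (c : Y) :
  equivalent f g -> (forall x, f x = c) -> forall x, g x = c.
Proof. by move=> [s [m [_ gE]]] fc x; rewrite gE /relabel fc. Qed.

Lemma equivalent_unary_cst f (c : Y) :
  (forall x, f x = c) -> equivalent f (unary (fun=> c)).
Proof.
by move=> fc; exists (fun=> ord0), (fun=> ord0);
  split; apply/funext => x; rewrite /relabel /= fc.
Qed.

Lemma section_self f x k : unary_section f x k (x k) = f x.
Proof.
by rewrite /unary_section; congr (fct_val f _); apply/ffunP => i; rewrite ffunE;
  case: eqP => // ->.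
Qed.

Lemma subst_at_twice n (x : (X ^ n)%type) (k : 'I_n) (a b : X) :
  subst_at (subst_at x k a) k b = subst_at x k b.
Proof. by apply/ffunP => i; rewrite !ffunE; case: eqP. Qed.

Lemma unary_sectionE (u : X -> Y) a k : unary_section (unary u) a k = u.
Proof.
by apply/funext => x; rewrite /unary_section /= ffunE (ord1 k) eqxx.
Qed.

Lemma essential_unary (x0 : X) (u : X -> Y) k :
  essential (unary u) k <-> ~ is_constant u.
Proof.
split; apply: contra_not; first by move=> uc a; rewrite unary_sectionE.
by move=> /(_ [ffun=> x0]); rewrite unary_sectionE.
Qed.

End Equivalence.

(** * Removing inessential arguments *)

Section Reduction.
Context {X Y : Type}.
Implicit Types (f g : fct X Y).

Definition reduced g : Prop := forall k : 'I_(arity g), ~ inessential g k.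

(** Induction on the arity: an inessential argument k can be deleted, and put
    back through [lift k]. An inessential argument is never the only one,
    because the function is not constant. *)
Lemma nonconstant_reduction (x0 : X) f :
  ~ is_constant f -> exists2 g, equivalent f g & reduced g.
Proof.
case: f => n; elim: n => [|n IHn] f fnc.
  exists (Fct f); first exact: equivalent_refl.
  move=> k /(_ [ffun=> x0]) [c fc]; apply: fnc; exists c => x.
  rewrite -(fc (x k)) /unary_section /=; congr f; apply/ffunP => i.
  by rewrite ffunE (ord1 i) (ord1 k) eqxx.
have [fred|/existsNP[k /contrapT fk]] := pselect (reduced (Fct f)).
  by exists (Fct f) => //; exact: equivalent_refl.
(* The value of [del] at k itself is arbitrary: f does not depend on it. *)
pose del (i : 'I_n.+2) : 'I_n.+1 := odflt ord0 (unlift k i).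
pose f' : fct X Y := Fct (relabel del f).
have ff' : equivalent (Fct f) f'.
  exists (lift k), del; split => //=; apply/funext => a; rewrite /relabel.
  have [c fc] := fk a.
  rewrite -[LHS](@section_self X Y (Fct f) a k) fc.
  rewrite -(fc (a (lift k (del k)))) /unary_section /=; congr f.
  apply/ffunP => i; rewrite !ffunE; case: eqP => [->//|/eqP ik].
  rewrite /del; case: unliftP ik => [j ->|->]; last by rewrite eqxx.
  by [].
have [|g f'g gred] := IHn (relabel del f).
  apply: contra_not fnc => -[c f'c]; exists c.
  exact: (equivalent_constant (equivalent_sym ff') f'c).
by exists g => //; exact: equivalent_trans ff' f'g.
Qed.

(** An argument of g outside the image of [mu \o sigma] would be inessential,
    since g is unchanged by composition with [mu \o sigma]. So this self-map of
    the set of arguments of g is onto, hence bijective. *)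
Lemma reduced_relabel_cancel f g
    (sigma : 'I_(arity g) -> 'I_(arity f)) (mu : 'I_(arity f) -> 'I_(arity g)) :
  reduced g -> fct_val f = relabel sigma g -> fct_val g = relabel mu f ->
  exists tau, cancel sigma tau.
Proof.
move=> gred fE gE; pose p := mu \o sigma.
have gp : fct_val g = relabel p g by rewrite /p -relabel_comp -fE.
have p_onto j : exists i, p i == j.
  apply: contrapT => /forallNP pj; apply: (gred j) => b.
  exists (g [ffun i => b (p i)]) => x; rewrite /unary_section [in LHS]gp.
  rewrite /relabel; congr (fct_val g _); apply/ffunP => i; rewrite !ffunE.
  by move: (pj i); case: (p i == j).
have p_inj : injective p.
  have : #|codom p| = #|'I_(arity g)|.
    by apply: eq_card => j; rewrite [RHS]inE; have [i /eqP <-] := p_onto j;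
      exact: codom_f.
  by move/eqP/image_injP => pI x y; exact: pI.
by exists (invF p_inj \o mu) => j; exact: (invF_f p_inj j).
Qed.

(** The section varies only in the k-th coordinate, which g reads through an
    argument j such that [sigma j = k]: there is one because k is essential,
    and no other because sigma is injective. *)
Lemma essential_section_reduced f g k a :
  equivalent f g -> reduced g -> essential f k ->
  exists j b, unary_section f a k = unary_section g b j.
Proof.
move=> [sigma [mu [fE gE]]] gred fk.
have [tau sigmaK] := reduced_relabel_cancel gred fE gE.
have [[j jk]|nk] := pselect (exists j, sigma j = k).
  exists j, [ffun i => a (sigma i)]; apply/funext => x.
  rewrite /unary_section fE /relabel; congr (fct_val g _); apply/ffunP => i.
  by rewrite !ffunE -jk (can_eq sigmaK).
case: fk => b; exists (g [ffun i => b (sigma i)]) => x.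
rewrite /unary_section fE /relabel; congr (fct_val g _); apply/ffunP => i.
by rewrite !ffunE; case: eqP => // ik; case: nk; exists i.
Qed.

Lemma reduced_section_essential f g j b :
  equivalent f g -> reduced g ->
  exists k a, essential f k /\ unary_section g b j = unary_section f a k.
Proof.
move=> [sigma [mu [fE gE]]] gred.
have [tau sigmaK] := reduced_relabel_cancel gred fE gE.
have gf c : unary_section g c j =
    unary_section f [ffun i => c (tau i)] (sigma j).
  apply/funext => x; rewrite /unary_section fE /relabel.
  congr (fct_val g _); apply/ffunP => i.
  by rewrite !ffunE (can_eq sigmaK) sigmaK.
exists (sigma j), [ffun i => b (tau i)]; split => // fk.
by apply: (gred j) => c; rewrite gf.
Qed.

(** Such a class contains a nonconstant function exactly when it contains
    certain unary functions, and a constant function exactly when it contains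
    the equivalent unary constant. *)
Lemma UM_characterized_eq (C1 C2 : set (fct X Y)) :
  UM_characterized C1 -> UM_characterized C2 ->
  (forall u, C1 (unary u) <-> C2 (unary u)) -> C1 = C2.
Proof.
have sub (A B : set (fct X Y)) : UM_characterized A -> UM_characterized B ->
    (forall u, A (unary u) <-> B (unary u)) -> A `<=` B.
  move=> [A1 A2] [B1 B2] AB f Af.
  have [[c fc]|fnc] := pselect (is_constant f).
    have fu := equivalent_unary_cst fc.
    have uc : is_constant (unary (fun=> c) : fct X Y) by exists c.
    apply: (B2 (unary (fun=> c))) => //; apply/AB/(A2 f) => //; first by exists c.
    exact: equivalent_sym.
  by apply/(B1 _ fnc) => k a fk; apply/AB; exact: (A1 _ fnc).1 Af k a fk.
move=> U1 U2 C12; apply/seteqP; split; apply: sub => // u.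
by split=> /C12.
Qed.

End Reduction.

(** * Pivotal decomposition on unary sections *)

Section PivotalClasses.
Context {X Y : Type} (zero one : X).
Implicit Types (f g : fct X Y) (D : set (X * (Y * Y))).

(** For a unary function, the domain condition and the decomposition identity
    merge into the existence of a point of D, which is unique. *)
Definition unary_decomposable D (Pi : D -> Y) (u : X -> Y) : Prop :=
  forall x, exists2 p : D, val p = (x, (u one, u zero)) & u x = Pi p.

(** The decomposition of f along the k-th argument at x only sees the values of
    the unary section through x at the points [x k], 1 and 0; conversely, the
    section through a is evaluated at x by f at the point [subst_at a k x]. *)
Lemma decomposable_sections D (Pi : D -> Y) f :
  decomposable zero one Pi f <->
  forall a k, unary_decomposable Pi (unary_section f a k).
Proof.
split=> [[fD fPi] a k x|fs].
  have Dx : D (x, (unary_section f a k one, unary_section f a k zero)).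
    by apply: fD; split => //; exists a, k.
  exists (SigSub (mem_set Dx)) => //.
  rewrite {1}/unary_section (fPi _ k (SigSub (mem_set Dx))) //=.
  by rewrite ffunE eqxx !subst_at_twice.
split=> [[x p] [_ [a [k /= ->]]]|x k p pE].
  by have [q <- _] := fs a k x; exact: set_mem (valP q).
have [q qE fq] := fs x k (x k).
rewrite -(section_self x k) fq; congr Pi; apply: val_inj.
by rewrite qE pE.
Qed.

(** If g were not constant, the sections of an equivalent function with only
    essential arguments would come from essential arguments of g. *)
Lemma inessential_constant g :
  (forall k, ~ essential g k) -> is_constant g.
Proof.
move=> gin; apply: contrapT => /(nonconstant_reduction zero)[h gh hred].
have [k [_ [gk _]]] := reduced_section_essential ord0 [ffun=> zero] gh hred.
exact: gin gk.
Qed.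

Lemma Gamma_nonconstant D (Pi : D -> Y) f : ~ is_constant f ->
  Gamma zero one Pi f <->
  forall k a, essential f k -> unary_decomposable Pi (unary_section f a k).
Proof.
move=> fnc; split=> [[g [fg gPi gor]] k a fk|fs].
  have gred : reduced g.
    case: gor => // /inessential_constant[c gc]; case: fnc; exists c.
    exact: equivalent_constant (equivalent_sym fg) gc.
  have [j [b ->]] := essential_section_reduced a fg gred fk.
  by move/decomposable_sections : gPi; apply.
have [g fg gred] := nonconstant_reduction zero fnc.
exists g; split => //; last by right.
apply/decomposable_sections => b j.
have [k [a [fk ->]]] := reduced_section_essential j b fg gred.
exact: fs.
Qed.

(** A nonconstant u is its own only essential section. If u is constant, then so
    is any function equivalent to it, and every section of that function is the
    map u itself. *)
Lemma Gamma_unary D (Pi : D -> Y) (u : X -> Y) :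
  Gamma zero one Pi (unary u) <-> unary_decomposable Pi u.
Proof.
split=> [Gu|uPi]; last first.
  exists (unary u); split; first exact: equivalent_refl.
    by apply/decomposable_sections => a k; rewrite unary_sectionE.
  have [u0|u0] := pselect (inessential (unary u) ord0); [left|right] => k;
    by rewrite (ord1 k) // => /(_ u0).
have [[c uc]|unc] := pselect (is_constant u).
  have [g [ug /decomposable_sections gs _]] := Gu.
  have gc : forall x, g x = c.
    by apply: (equivalent_constant ug) => x /=; rewrite uc.
  suff -> : u = unary_section g [ffun=> zero] ord0 by exact: gs.
  by apply/funext => x; rewrite uc /unary_section gc.
have unc' : ~ is_constant (unary u).
  apply: contra_not unc => -[c uc]; exists c => x.
  by rewrite -(uc [ffun=> x]) /= ffunE.
have := (Gamma_nonconstant Pi unc').1 Gu ord0 [ffun=> zero].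
by rewrite unary_sectionE; apply; apply/essential_unary.
Qed.

Lemma Gamma_UM_characterized D (Pi : D -> Y) :
  UM_characterized (Gamma zero one Pi).
Proof.
split=> [f /Gamma_nonconstant fP|f g _ [h [fh hPi hor]] gf].
  by rewrite fP; split=> fs k a fk; apply/Gamma_unary; exact: fs.
by exists h; split => //; exact: equivalent_trans gf fh.
Qed.

Lemma unary_decomposable_restrict D (Pi : D -> Y) (C : set (fct X Y)) u :
  unary_decomposable (pivotal_restrict zero one Pi C) u <->
  unary_decomposable Pi u /\ class_pairs zero one C (u one, u zero).
Proof.
split=> [uPi|[uPi uC] x].
  split=> [x|]; last by have [p pE _] := uPi zero;
    have := set_mem (valP p); rewrite pE => -[_ [_ ?]].
  have [p pE ->] := uPi x.
  by eexists; last reflexivity.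
have [p pE ->] := uPi x.
have DR : (D `&` ([set: X] `*` class_pairs zero one C)) (val p).
  by split; [exact: set_mem (valP p)|rewrite pE].
exists (SigSub (mem_set DR)) => //.
by rewrite /pivotal_restrict; congr Pi; apply: val_inj.
Qed.

Lemma unary_decomposable_eq D (Pi : D -> Y) (u v : X -> Y) :
  unary_decomposable Pi u -> unary_decomposable Pi v ->
  (u one, u zero) = (v one, v zero) -> u = v.
Proof.
move=> uPi vPi uv; apply/funext => x.
have [p pE ->] := uPi x; have [q qE ->] := vPi x.
by congr Pi; apply: val_inj; rewrite pE qE uv.
Qed.

Lemma UM_characterized_restrict D (Pi : D -> Y) (C : set (fct X Y)) :
  C `<=` Gamma zero one Pi -> UM_characterized C ->
  C = Gamma zero one (pivotal_restrict zero one Pi C).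
Proof.
move=> CPi UC; apply: UM_characterized_eq => //;
  first exact: Gamma_UM_characterized.
move=> u; rewrite Gamma_unary unary_decomposable_restrict.
split=> [Cu|[uPi [v [Cv uv]]]].
  by split; [apply/Gamma_unary; exact: CPi|exists u].
by rewrite (unary_decomposable_eq uPi _ uv) //; apply/Gamma_unary; exact: CPi.
Qed.

End PivotalClasses.

Theorem theorem4p5 (X Y : Type) (X_nonempty : inhabited X)
    (Y_nonempty : inhabited Y) (zero one : X)
    (D : set (X * (Y * Y))) (Pi : D -> Y) (C : set (fct X Y))
    (C_nonempty : C !=set0) (C_sub : C `<=` Gamma zero one Pi) :
  (UM_characterized C <-> pivotally_characterized zero one C) /\
  (UM_characterized C \/ pivotally_characterized zero one C ->
   C = Gamma zero one (pivotal_restrict zero one Pi C)).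
Proof.
have pivot_UM : pivotally_characterized zero one C -> UM_characterized C.
  by move=> [D' [Pi' ->]]; exact: Gamma_UM_characterized.
have restrictE := UM_characterized_restrict C_sub.
split; last by move=> [|/pivot_UM] /restrictE.
by split=> [/restrictE CE|//]; exists _, (pivotal_restrict zero one Pi C).
Qed.
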